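(* Let $G$ be a finite simple undirected graph on $n$ vertices with minimum degree $\delta \ge 3$, and let $\mu_2$ and $\mu_n$ denote the second smallest and the largest eigenvalue of the Laplacian matrix of $G$, respectively. If $(\delta - 1)\mu_2 \ge \mu_n$, then $G$ has an even spanning subgraph.
   Context: The Laplacian matrix of a graph $G$ is $L = D - A$, where $D$ is the diagonal matrix of vertex degrees and $A$ is the adjacency matrix. The eigenvalues of $L$ are listed with multiplicity in nondecreasing order $0=\mu_1 \le \mu_2 \le \cdots \le \mu_n$. A graph is called even if the degree of each of its vertices is a positive even integer. A spanning subgraph of $G$ is a subgraph with vertex set $V(G)$; thus an even spanning subgraph is one in which every vertex of $G$ has positive even degree (connectedness is not required). *)

(* Defs.v *)
From mathcomp Require Import all_boot all_order all_algebra.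
Set Implicit Arguments.
Unset Strict Implicit.
Unset Printing Implicit Defensive.
Import Order.TTheory GRing.Theory Num.Theory.
Local Open Scope ring_scope.

Definition simple_graph (V : finType) (e : rel V) : Prop :=
  symmetric e /\ irreflexive e.

Definition degree (V : finType) (e : rel V) (v : V) : nat := #|[set w | e v w]|.

Definition is_min_degree (V : finType) (e : rel V) (d : nat) : Prop :=
  (exists v, degree e v = d) /\ (forall v, (d <= degree e v)%N).

(* Rows and columns are indexed by 'I_#|V| through the enumeration of V. *)
Definition adjacency_mx (R : pzRingType) (V : finType) (e : rel V) : 'M[R]_#|V| :=
  \matrix_(i, j) (e (enum_val i) (enum_val j))%:R.

Definition degree_mx (R : pzRingType) (V : finType) (e : rel V) : 'M[R]_#|V| :=
  diag_mx (\row_i (degree e (enum_val i))%:R).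

Definition laplacian_mx (R : pzRingType) (V : finType) (e : rel V) : 'M[R]_#|V| :=
  degree_mx R e - adjacency_mx R e.

(* s lists all n eigenvalues of A with algebraic multiplicity, in nondecreasing
   order; such an s is unique, and exists for every symmetric A over a real
   closed field. It is indexed from 0, so the k-th eigenvalue is s`_(k.-1). *)
Definition ordered_eigenvalues (R : rcfType) (n : nat) (A : 'M[R]_n)
    (s : seq R) : Prop :=
  sorted <=%R s /\ char_poly A = \prod_(x <- s) ('X - x%:P).

Definition even_graph (V : finType) (e : rel V) : Prop :=
  forall v, (0 < degree e v)%N /\ ~~ odd (degree e v).

(* h is a graph on the same vertex type V, hence spanning. *)
Definition spanning_subgraph (V : finType) (h e : rel V) : Prop :=
  simple_graph h /\ subrel h e.

(* Main.v *)
Require Import Defs.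
From mathcomp Require Import all_boot all_order all_algebra.
From mathcomp Require Import complex zify ring lra.
Set Implicit Arguments.
Unset Strict Implicit.
Unset Printing Implicit Defensive.
Import Order.TTheory GRing.Theory Num.Theory.

(** The theorem splits into a spectral half and a combinatorial half, which meet
    in the absence of an edge cut of size one.

    Spectral half ([no_bridge_of_spectrum]). Suppose that exactly one edge leaves
    a vertex set [W]. As all degrees are at least 3, neither [W] nor its
    complement is a single vertex. The vector equal to [#|~: W|] on [W] and to
    [- #|W|] elsewhere is orthogonal to the constants, and its Rayleigh quotient is
    [#|V| / (#|W| * #|~: W|)], that is [1 / #|W| + 1 / #|~: W|], hence at most 1.
    So the second eigenvalue is at most 1 ([second_eigenvalue_le]) and, by the
    spectral hypothesis, the largest one is at most [delta - 1]. But the largest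
    eigenvalue is at least the mean of all of them, which is the average degree
    ([trace_le_largest]), hence at least [delta]: a contradiction.

    Combinatorial half ([even_spanning_subgraph_of_bridgeless]). A graph of
    minimum degree at least 3 without a cut of size one has an even spanning
    subgraph. Blow up every vertex [v] into a clique of darts, one for each edge
    at [v], plus two extra core vertices joined to these darts, and join the two
    darts of each edge. In a perfect matching of this gadget graph, call an edge
    selected when its darts are not matched with each other. Among the darts at
    [v], two are matched with the cores and the other selected ones are matched
    in pairs, so that the number of selected edges at [v] is even and positive.

    The perfect matching comes from Tutte's theorem. If there were none, a
    smallest barrier [S] would have more than [#|S|] odd parts, and each of its
    elements would touch at least three parts. An element of the gadget of [v]
    touches at most two parts as soon as some dart at [v] is outside [S], so [S]
    contains all the darts at each vertex of the set [U] of those vertices whose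
    gadgets it meets. The cores over [U] account for at most [2 * #|U|] parts,
    which is at most two thirds of [#|S|] because all degrees are at least 3. Any
    other odd part is the union of the gadgets over a vertex set whose edge cut
    has the same parity as the part; being odd and not 1, this cut has at least
    three edges, each of which ends in a dart of [S]. This gives at most
    [#|S| / 3] further parts, so at most [#|S|] odd parts in all: a
    contradiction. *)

(** * Hall's marriage theorem *)

Definition neighbours (S U : finType) (r : S -> U -> bool) (X : {set S}) : {set U} :=
  [set u | [exists x in X, r x u]].

Lemma neighboursP (S U : finType) (r : S -> U -> bool) (X : {set S}) u :
  reflect (exists2 x, x \in X & r x u) (u \in neighbours r X).
Proof. by rewrite inE; exact: (iffP exists_inP). Qed.

(** By induction on [#|A|]. If some proper nonempty [X] is tight, meaning that it
    has exactly [#|X|] neighbours, then match [X] with these and the rest of [A]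
    with the remaining elements; otherwise every such set has a neighbour to
    spare, so any one pair can be matched and removed. The element [u0] serves
    only to build a total function. *)
Lemma hall_marriage (S U : finType) (u0 : U) (r : S -> U -> bool) (A : {set S}) :
    (forall X : {set S}, X \subset A -> #|X| <= #|neighbours r X|) ->
  exists f : S -> U, {in A &, injective f} /\ {in A, forall x, r x (f x)}.
Proof.
have [n] := ubnP #|A|; elim: n => // n IHn in r A *; rewrite ltnS => leAn hallA.
have [->|[a aA]] := set_0Vmem A.
  by exists (fun=> u0); split=> x; rewrite inE.
(* A proper nonempty tight set [X], or none. *)
have [/existsP[X /and3P[X0 XA /eqP tightX]]|/existsPn loose] :=
    boolP [exists X : {set S},
      [&& X != set0, X \proper A & #|neighbours r X| == #|X|]].
  have sXA := proper_sub XA.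
  have [|Y YX|f1 [inj1 r1]] := IHn r X.
  - exact: leq_trans (proper_card XA) leAn.
  - exact/hallA/(subset_trans YX).
  pose r2 x u := r x u && (u \notin neighbours r X).
  have [||f2 [inj2 r2P]] := IHn r2 (A :\: X).
  - apply: leq_trans leAn; apply/proper_card/properP; split; first exact: subsetDl.
    by case/set0Pn: X0 => x xX; exists x; rewrite ?(subsetP sXA) // inE xX.
  - move=> Y; rewrite subsetD => /andP[YA YX].
    have : #|X :|: Y| <= #|neighbours r (X :|: Y)|.
      by apply: hallA; rewrite subUset sXA.
    have /leqifP := leq_card_setU X Y; rewrite disjoint_sym YX => /eqP ->.
    rewrite -tightX => /leq_trans le; rewrite -(leq_add2l #|neighbours r X|).
    apply: le; apply: leq_trans (leq_card_setU _ _); apply/subset_leq_card.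
    apply/subsetP=> u /neighboursP[x]; rewrite 2!inE.
    have [uX _ _|uX] := boolP (u \in neighbours r X); first by [].
    case/orP=> [xX rxu|xY rxu]; first by case/neighboursP: uX; exists x.
    by apply/orP; right; apply/neighboursP; exists x; rewrite // /r2 rxu.
  have f1X x : x \in X -> f1 x \in neighbours r X.
    by move=> xX; apply/neighboursP; exists x => //; exact: r1.
  have f2X x : x \in A -> x \notin X -> f2 x \notin neighbours r X.
    by move=> xA xX; have /andP[] : r2 x (f2 x) by apply: r2P; rewrite inE xX.
  exists (fun x => if x \in X then f1 x else f2 x); split=> [x y xA yA|x xA].
    case: ifPn => xX; case: ifPn => yX.
    + exact: inj1.
    + by move=> E; case/negP: (f2X y yA yX); rewrite -E f1X.
    + by move=> E; case/negP: (f2X x xA xX); rewrite E f1X.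
    + by apply: inj2; rewrite inE ?xX ?yX.
  case: ifPn => xX; first exact: r1.
  by have /andP[] : r2 x (f2 x) by apply: r2P; rewrite inE xX.
have [b rab] : exists b, r a b.
  have := hallA [set a]; rewrite sub1set cards1 card_gt0 => /(_ aA) /set0Pn[b].
  by case/neighboursP=> x /set1P -> ?; exists b.
pose r2 x u := r x u && (u != b).
have [||f2 [inj2 r2P]] := IHn r2 (A :\ a).
- by move: leAn; rewrite (cardsD1 a A) aA.
- move=> Y YA; have [->|Y0] := eqVneq Y set0; first by rewrite cards0.
  have YpA : Y \proper A by apply: sub_proper_trans YA (properD1 aA).
  have := loose Y; rewrite Y0 YpA /= => neq.
  have := hallA Y (proper_sub YpA); rewrite leq_eqVlt eq_sym (negPf neq) /=.
  rewrite (cardsD1 b) => lt; have : #|Y| <= #|neighbours r Y :\ b| by lia.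
  move/leq_trans; apply; apply/subset_leq_card/subsetP=> u.
  rewrite in_setD1 => /andP[ub /neighboursP[x xY rxu]].
  by apply/neighboursP; exists x; rewrite // /r2 rxu.
have f2b x : x \in A -> x != a -> f2 x != b.
  by move=> xA xa; have /andP[] : r2 x (f2 x) by apply: r2P; rewrite !inE xa.
exists (fun x => if x == a then b else f2 x); split=> [x y xA yA|x xA].
  case: eqVneq => [->|xa]; case: eqVneq => [->|ya] //.
  + by move=> E; case/negP: (f2b y yA ya); rewrite E.
  + by move=> E; case/negP: (f2b x xA xa); rewrite E.
  + by apply: inj2; rewrite !inE ?xa ?ya.
case: eqVneq => [->|xa] //.
by have /andP[] : r2 x (f2 x) by apply: r2P; rewrite !inE xa.
Qed.

(** * Tutte's theorem on perfect matchings *)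

Definition odd_parts (T : finType) (P : {set {set T}}) : {set {set T}} :=
  [set C in P | odd #|C|].

Lemma odd_card_partition (T : finType) (P : {set {set T}}) (B : {set T}) :
  partition P B -> odd #|B| = odd #|odd_parts P|.
Proof.
move/card_partition->; rewrite -sum1_card (big_morph odd oddD (erefl _)).
rewrite (big_morph odd oddD (erefl _)) [RHS]big_mkcond [LHS]big_mkcond /=.
by apply: eq_bigr => C _; rewrite inE; case: (C \in P); case: (odd #|C|).
Qed.

Section Tutte.
Variables (T : finType) (g : rel T).
Hypothesis symg : symmetric g.
Implicit Types (A S X C : {set T}) (P Q N : {set {set T}}).

Definition perfect_matching A (m : T -> T) :=
  {in A, forall x, [/\ m x \in A, g x (m x) & m (m x) = x]}.

(** The role of the components of [A :\: S] is played by arbitrary unions of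
    components: no edge leaves a part of [P], except into [S]. Parts can then be
    merged and subdivided without any argument about connectivity, and a
    violation of Tutte's condition by such parts is one by components too, since
    an odd union of components contains an odd component. *)
Definition separation A S P :=
  [&& S \subset A, partition P (A :\: S)
    & [forall C in P, forall x in C, forall y in A :\: S, g x y ==> (y \in C)]].

Lemma separationP A S P :
  reflect [/\ S \subset A, partition P (A :\: S)
            & forall C x y, C \in P -> x \in C -> y \in A :\: S -> g x y -> y \in C]
          (separation A S P).
Proof.
apply: (iffP and3P) => -[sSA partP sep]; split=> //.
  move=> C x y CP xC yA gxy.
  by move/forall_inP/(_ C CP)/forall_inP/(_ x xC)/forall_inP/(_ y yA)/implyP: sep; apply.
apply/forall_inP=> C CP; apply/forall_inP=> x xC; apply/forall_inP=> y yA.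
by apply/implyP; apply: sep xC yA.
Qed.

(** A separation of a single part [C] can be spliced into a separation of the
    whole set. *)
Lemma separation_refine A S P C X Q :
    separation A S P -> C \in P -> separation C X Q ->
  separation A (S :|: X) (Q :|: P :\ C)
  /\ #|odd_parts (Q :|: P :\ C)| = #|odd_parts Q| + #|odd_parts P| - odd #|C|.
Proof.
move=> /separationP[sSA partP sepP] CP /separationP[sXC partQ sepQ].
have /and3P[/eqP covP trivP P0] := partP.
have /and3P[/eqP covQ trivQ Q0] := partQ.
have sCA : C \subset A :\: S by rewrite -covP; exact: bigcup_sup.
have QC D : D \in Q -> D \subset C :\: X by move=> DQ; rewrite -covQ; exact: bigcup_sup.
have PC D : D \in P -> D \subset A :\: S by move=> DP; rewrite -covP; exact: bigcup_sup.
have disjPC D : D \in P -> D != C -> [disjoint D & C].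
  by move=> DP DC; move/trivIsetP: trivP; apply.
have covQP : cover (Q :|: P :\ C) = A :\: (S :|: X).
  apply/setP=> x; apply/bigcupP/idP.
    case=> D /setUP[/QC/subsetP sD /sD|/setD1P[DC DP] xD].
      rewrite !inE => /andP[xX xC]; move/subsetP: sCA => /(_ x xC).
      by rewrite !inE (negPf xX) orbF.
    move/subsetP: (PC D DP) => /(_ x xD); rewrite !inE => /andP[xS ->].
    rewrite (negPf xS) andbT /=; apply: contraL (xD) => xX.
    by rewrite (disjointFl (disjPC D DP DC)) // (subsetP sXC).
  rewrite !inE negb_or -andbA => /and3P[xS xX xA].
  have : x \in cover P by rewrite covP inE xS.
  case/bigcupP=> D DP xD; have [DC|DC] := eqVneq D C.
    have : x \in cover Q by rewrite covQ inE xX -DC.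
    by case/bigcupP=> E EQ xE; exists E => //; rewrite inE EQ.
  by exists D; rewrite // !inE DC DP orbT.
have disjQP D E : D \in Q -> E \in P -> E != C -> [disjoint D & E].
  move=> DQ EP EC; apply: disjointWl (subset_trans (QC D DQ) (subsetDl _ _)) _.
  by rewrite disjoint_sym disjPC.
split.
  apply/separationP; split.
  - by rewrite subUset sSA; apply: subset_trans sXC (subset_trans sCA (subsetDl _ _)).
  - apply/and3P; split; first by rewrite covQP.
      apply/trivIsetP=> D E /setUP[DQ|/setD1P[DC DP]] /setUP[EQ|/setD1P[EC EP]] DE.
      + by move/trivIsetP: trivQ; apply.
      + exact: disjQP.
      + by rewrite disjoint_sym disjQP.
      + by move/trivIsetP: trivP; apply.
    by rewrite !inE (negPf Q0) (negPf P0) andbF.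
  move=> D x y /setUP[DQ|/setD1P[DC DP]] xD; rewrite !inE negb_or -andbA.
    move=> /and3P[yS yX yA] gxy; have xC : x \in C.
      by have := subsetP (QC D DQ) x xD; rewrite inE => /andP[].
    have yC : y \in C by apply: sepP gxy; rewrite // inE yS.
    by apply: sepQ gxy; rewrite // inE yX.
  by move=> /and3P[yS yX yA] gxy; apply: sepP gxy; rewrite // inE yS.
have -> : odd_parts (Q :|: P :\ C) = odd_parts Q :|: odd_parts P :\ C.
  by apply/setP=> D; rewrite !inE; do ?case: (_ \in _); case: (D == C); case: (odd _).
rewrite cardsU.
have -> : odd_parts Q :&: (odd_parts P :\ C) = set0.
  apply/setP=> D; rewrite !inE; apply/negP=> /andP[/andP[DQ _] /and3P[DC DP _]].
  move: (disjQP D D DQ DP DC); rewrite -setI_eq0 setIid => /eqP D0.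
  by rewrite D0 (negPf Q0) in DQ.
by rewrite cards0 subn0 (cardsD1 C (odd_parts P)) inE CP /= addnCA addKn.
Qed.

(** Elements can be taken back from [S] at the price of merging with them all
    the parts that they touch. *)
Lemma separation_merge A S P X N :
    separation A S P -> X \subset S -> X != set0 -> N \subset P ->
    (forall x y C, x \in X -> C \in P -> y \in C -> g x y -> C \in N) ->
  separation A (S :\: X) ((X :|: cover N) |: (P :\: N)).
Proof.
move=> /separationP[sSA partP sepP] sXS X0 sNP XN.
have /and3P[/eqP covP trivP P0] := partP.
have PC D : D \in P -> D \subset A :\: S by move=> DP; rewrite -covP; exact: bigcup_sup.
have covD x D : D \in P -> D \notin N -> x \in D -> x \notin X :|: cover N.
  move=> DP DN xD; rewrite inE negb_or; apply/andP; split.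
    have := subsetP (PC D DP) x xD; rewrite inE => /andP[xS _].
    by apply: contra xS => /(subsetP sXS).
  apply/bigcupP=> -[E EN xE]; case/negP: DN.
  have EP := subsetP sNP E EN.
  by rewrite -(def_pblock trivP DP xD) (def_pblock trivP EP xE).
apply/separationP; split.
- exact: subset_trans (subsetDl _ _) sSA.
- apply/and3P; split.
  + apply/eqP/setP=> x; apply/bigcupP/idP.
      case=> D /setU1P[->|/setDP[DP DN] xD].
        case/setUP=> [xX|/bigcupP[E EN xE]].
          by rewrite !inE xX (subsetP sSA) // (subsetP sXS).
        have := subsetP (PC E (subsetP sNP E EN)) x xE.
        by rewrite !inE => /andP[/negPf -> ->]; rewrite andbF.
      by have := subsetP (PC D DP) x xD; rewrite !inE => /andP[/negPf -> ->]; rewrite andbF.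
    rewrite !inE negb_and negbK => /andP[xXS xA].
    have [xX|xX] := boolP (x \in X).
      by exists (X :|: cover N); rewrite !inE ?eqxx ?xX.
    rewrite (negPf xX) /= in xXS.
    have : x \in cover P by rewrite covP inE xXS.
    case/bigcupP=> D DP xD; have [DN|DN] := boolP (D \in N).
      exists (X :|: cover N); rewrite ?inE ?eqxx //.
      by apply/orP; right; apply/bigcupP; exists D.
    by exists D; rewrite // !inE DN DP orbT.
  + have disj D : D \in P :\: N -> [disjoint X :|: cover N & D].
      case/setDP=> DP DN; rewrite disjoint_sym; apply/pred0P=> x /=.
      by apply/andP=> -[xD]; apply/negP/(covD x D).
    apply/trivIsetP=> D E /setU1P[->|DP] /setU1P[->|EP] DE.
    * by rewrite eqxx in DE.
    * exact: disj.
    * by rewrite disjoint_sym disj.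
    * by move/trivIsetP: trivP; apply=> //; [case/setDP: DP|case/setDP: EP].
  + rewrite !inE (negPf P0) andbF orbF eq_sym; case/set0Pn: X0 => x xX.
    by apply/set0Pn; exists x; rewrite inE xX.
move=> D x y /setU1P[->|/setDP[DP DN] xD]; rewrite !inE negb_and negbK.
  move=> xM /andP[yXS yA] gxy; have [//|yX /=] := boolP (y \in X).
  rewrite (negPf yX) /= in yXS.
  have yAS : y \in A :\: S by rewrite inE yXS.
  case/orP: xM => [xX|/bigcupP[E EN xE]].
    have := yAS; rewrite -covP => /bigcupP[E EP yE].
    by apply/bigcupP; exists E => //; exact: XN xX EP yE gxy.
  apply/bigcupP; exists E => //; apply: sepP gxy => //.
  exact: subsetP sNP E EN.
move=> /andP[yXS yA] gxy; have [yX|yX] := boolP (y \in X).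
  by case/negP: DN; apply: (XN y x) => //; rewrite symg.
by apply: sepP gxy; rewrite // inE yA andbT; rewrite (negPf yX) in yXS.
Qed.

Lemma card_odd_parts_merge P C N :
  #|odd_parts P| - #|odd_parts N| <= #|odd_parts (C |: (P :\: N))|.
Proof.
have : odd_parts P \subset odd_parts N :|: odd_parts (C |: (P :\: N)).
  apply/subsetP=> D; rewrite !inE => /andP[-> ->].
  by case: (D \in N); rewrite ?orbT.
by move/subset_leq_card/leq_trans/(_ (leq_card_setU _ _)); lia.
Qed.

Lemma separation_trivial A X :
  X \proper A -> separation A X [set A :\: X].
Proof.
case/properP=> sXA [a aA aX]; apply/separationP; split=> //.
  apply/and3P; split; first by rewrite /cover big_set1.
    by apply/trivIsetP=> D E /set1P-> /set1P->; rewrite eqxx.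
  by rewrite inE eq_sym; apply/set0Pn; exists a; rewrite inE aX.
by move=> C x y /set1P->.
Qed.

Lemma card_odd_parts1 C : #|odd_parts [set C]| = odd #|C|.
Proof.
have [oC|oC] := boolP (odd #|C|).
  rewrite (_ : odd_parts _ = [set C]) ?cards1 //; apply/setP=> D; rewrite !inE.
  by case: eqVneq => // ->.
apply/eqP; rewrite cards_eq0; apply/eqP/setP=> D; rewrite !inE.
by case: eqVneq => // ->; exact: negbTE.
Qed.

(** The perfect matching in the last step of Tutte's theorem: each [x] in [S] is
    matched with [y x] in its own part [f x], and the rest of that part is
    matched by [mm x]. *)
Lemma glue_matching A S P (f : T -> {set T}) (y : T -> T) (mm : T -> T -> T) :
    separation A S P ->
    {in S &, injective f} -> {in S, forall x, f x \in P} ->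
    {in P, forall C, exists2 x, x \in S & f x = C} ->
    {in S, forall x, [/\ y x \in f x, g x (y x)
                       & perfect_matching (f x :\ y x) (mm x)]} ->
  exists m, perfect_matching A m.
Proof.
case/separationP=> sSA /and3P[/eqP covP trivP _] _ injf fP surjf mmP.
pose owner z := if [pick x in S | z \in f x] is Some x then x else z.
have fA x z : x \in S -> z \in f x -> (z \in A) && (z \notin S).
  move=> xS zf; have : z \in cover P by apply/bigcupP; exists (f x) => //; exact: fP.
  by rewrite covP inE andbC.
have ownerE x z : x \in S -> z \in f x -> owner z = x.
  move=> xS zf; rewrite /owner; case: pickP => [x' /andP[x'S zf']|/(_ x)]; last first.
    by rewrite xS zf.
  apply: injf => //.
  by rewrite -(def_pblock trivP (fP x xS) zf) (def_pblock trivP (fP x' x'S) zf').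
pose m z := if z \in S then y z else
  let x := owner z in if z == y x then x else mm x z.
have mE x z : x \in S -> z \in f x -> m z = if z == y x then x else mm x z.
  move=> xS zf; rewrite /m; have /andP[_ /negPf ->] := fA x z xS zf.
  by rewrite (ownerE x).
exists m => z zA; have [zS|zS] := boolP (z \in S).
  have [yf gy _] := mmP z zS; rewrite (mE z (m z)) /m zS ?eqxx //; split=> //.
  by have /andP[] := fA z _ zS yf.
have : z \in cover P by rewrite covP inE zS.
case/bigcupP=> C /surjf[x xS <-] zf; have [yf gy pm] := mmP x xS.
rewrite (mE x z) //; case: eqVneq => [->|zy].
  by rewrite symg gy (subsetP sSA) //; split=> //; rewrite /m xS.
have [] := pm z; first by rewrite !inE zy.
rewrite !inE => /andP[my mf] gm mmz.
rewrite (mE x) // (negPf my) mmz gm; split=> //.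
by have /andP[] := fA x _ xS mf.
Qed.

(** Suppose that no separation has more odd parts than elements of [S]. Among the
    tight separations, those with equality, take one with [S] as large as
    possible. By maximality, no refinement of a part is again tight; hence all
    parts are odd, and a part minus any of its elements again satisfies Tutte's
    condition, so that it has a perfect matching by induction. Merging
    parts shows Hall's condition for [S] and the parts that it touches. As there
    are exactly [#|S|] parts, each of them is matched with one element of [S],
    which takes one of its elements as a partner. *)
Theorem tutte A :
  (exists m, perfect_matching A m) \/
  (exists S P, separation A S P /\ #|S| < #|odd_parts P|).
Proof.
have [n] := ubnP #|A|; elim: n => // n IHn in A *; rewrite ltnS => leAn.
have [->|A0] := eqVneq A set0.
  by left; exists id => x; rewrite inE.
have [/existsP[S /existsP[P /andP[sepP lt]]]|] :=
    boolP [exists S, exists P, separation A S P && (#|S| < #|odd_parts P|)].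
  by right; exists S, P.
move=> /existsPn noBarrier; left.
have le_odd S P : separation A S P -> #|odd_parts P| <= #|S|.
  by move=> sepP; have /existsPn/(_ P) := noBarrier S; rewrite sepP -leqNgt.
have A0p : set0 \proper A by rewrite proper0.
have evenA : ~~ odd #|A|.
  have := le_odd _ _ (separation_trivial A0p).
  by rewrite card_odd_parts1 setD0 cards0; case: (odd _).
pose tight (SP : {set T} * {set {set T}}) :=
  separation A SP.1 SP.2 && (#|SP.1| <= #|odd_parts SP.2|).
have tight0 : tight (set0, [set A :\: set0]).
  by rewrite /tight separation_trivial ?cards0.
have [[S P] /andP[/= sepP tightP] maxSP] := 
  arg_maxnP (fun SP : {set T} * {set {set T}} => #|SP.1|) tight0.
have eqSP : #|odd_parts P| = #|S| by apply/anti_leq; rewrite tightP le_odd.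
have /separationP[sSA partP edgeP] := sepP.
have /and3P[/eqP covP trivP P0] := partP.
have PC D : D \in P -> D \subset A :\: S by move=> DP; rewrite -covP; exact: bigcup_sup.
have disjXS C X : C \in P -> X \subset C -> #|S :|: X| = #|S| + #|X|.
  move=> CP sXC; have /leqifP := leq_card_setU S X; case: ifP => [_ /eqP //|].
  case/negP; have := subset_trans sXC (PC C CP).
  by rewrite subsetD disjoint_sym => /andP[].
(* A violation would be a tight separation with a larger [S]. *)
have no_refine C X Q : C \in P -> X != set0 -> separation C X Q ->
    #|odd_parts Q| < #|X| + odd #|C|.
  move=> CP X0 sepQ; have /separationP[sXC _ _] := sepQ.
  have [sepQP cardQP] := separation_refine sepP CP sepQ.
  rewrite ltnNge; apply/negP=> le.
  have: tight (S :|: X, Q :|: P :\ C).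
    rewrite /tight sepQP /= cardQP eqSP (disjXS C) //.
    move: le; move: #|odd_parts Q| #|X| #|S| (odd #|C|); clear => q x s o; lia.
  move/maxSP; rewrite /= (disjXS C) // -[X in _ <= X -> _]addn0 leq_add2l leqn0.
  by rewrite cards_eq0 (negPf X0).
(* In an even part, moving one element to [S] would leave an odd part. *)
have oddP C : C \in P -> odd #|C|.
  move=> CP; apply/negPn/negP=> evenC.
  have /set0Pn[u uC] : C != set0 by apply: contraNneq P0 => <-.
  have uC1 : [set u] \proper C.
    rewrite properEcard sub1set uC cards1; move: evenC (uC).
    by rewrite (cardsD1 u C) uC; case: #|_ :\ _|.
  have u0 : [set u] != set0 by apply/set0Pn; exists u; rewrite inE.
  have := no_refine C [set u] _ CP u0 (separation_trivial uC1).
  rewrite card_odd_parts1 cards1 (negPf evenC).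
  by move: evenC; rewrite (cardsD1 u C) uC /= negbK => ->.
have card_P : #|P| = #|S|.
  rewrite -eqSP; congr #|pred_of_set _|; apply/setP=> C; rewrite inE.
  by case: (boolP (C \in P)) => // /oddP ->.
have part_matching C u : C \in P -> u \in C -> exists m, perfect_matching (C :\ u) m.
  move=> CP uC; have [|//|[X [Q [sepQ ltQ]]]] := IHn (C :\ u).
    apply: leq_trans leAn; apply: proper_card; apply: proper_sub_trans (properD1 uC) _.
    exact: subset_trans (PC C CP) (subsetDl _ _).
  have /separationP[sXC partQ edgeQ] := sepQ.
  have uX : u \notin X by apply/negP=> /(subsetP sXC); rewrite !inE eqxx.
  have sepQ' : separation C (u |: X) Q.
    have eD : C :\: (u |: X) = C :\ u :\: X by rewrite setDDl.
    apply/separationP; rewrite eD; split=> //.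
    rewrite subUset sub1set uC; exact: subset_trans sXC (subsetDl _ _).
  have uX0 : u |: X != set0 by apply/set0Pn; exists u; rewrite !inE eqxx.
  have := no_refine C _ Q CP uX0 sepQ'; rewrite oddP // cardsU1 uX.
  (* By parity, a violation in [C :\ u] has an excess of at least 2. *)
  have := odd_card_partition partQ.
  have := cardsID X (C :\ u); rewrite (setIidPr sXC).
  have := oddP C CP; rewrite (cardsD1 u C) uC.
  move: ltQ; move: #|odd_parts Q| #|X| #|C :\ u| #|_ :\: X|; clear => q x c d; lia.
pose r x C := (C \in P) && [exists y in C, g x y].
have hallS X : X \subset S -> #|X| <= #|neighbours r X|.
  move=> sXS; rewrite leqNgt; apply/negP=> lt.
  have X0 : X != set0 by apply: contraTneq lt => ->; rewrite cards0 ltn0.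
  have sNP : neighbours r X \subset P.
    by apply/subsetP=> C /neighboursP[x _ /andP[]].
  have XN x y C : x \in X -> C \in P -> y \in C -> g x y -> C \in neighbours r X.
    move=> xX CP yC gxy; apply/neighboursP; exists x => //; rewrite /r CP.
    by apply/exists_inP; exists y.
  have /le_odd := separation_merge sepP sXS X0 sNP XN.
  have := card_odd_parts_merge P (X :|: cover (neighbours r X)) (neighbours r X).
  have : #|odd_parts (neighbours r X)| <= #|neighbours r X|.
    by apply/subset_leq_card/subsetP=> C; rewrite inE => /andP[].
  have := cardsID X S; rewrite (setIidPr sXS).
  move: lt tightP.
  move: #|neighbours r X| #|odd_parts (neighbours r X)| #|odd_parts P|.
  move: #|_ :\: _| #|X| #|S| #|odd_parts _|.
  by clear; lia.
have [f [injf rf]] := hall_marriage set0 hallS.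
have fP : {in S, forall x, f x \in P} by move=> x /rf/andP[].
have imf : f @: S = P.
  apply/eqP; rewrite eqEcard card_P card_in_imset // leqnn andbT.
  by apply/subsetP=> C /imsetP[x xS ->]; exact: fP.
have /fin_all_exists[ym ymP] : forall x : T, exists ym : T * (T -> T), x \in S ->
    [/\ ym.1 \in f x, g x ym.1 & perfect_matching (f x :\ ym.1) ym.2].
  move=> x; case: (boolP (x \in S)) => xS; last by exists (x, id).
  have /andP[_ /exists_inP[y yf gxy]] := rf x xS.
  by have [m pm] := part_matching _ y (fP x xS) yf; exists (y, m).
apply: (glue_matching (y := fun x => (ym x).1) (mm := fun x => (ym x).2) sepP injf fP).
  by move=> C; rewrite -imf => /imsetP[x xS ->]; exists x.
by move=> x /ymP.
Qed.

Definition touching (P : {set {set T}}) (x : T) : {set {set T}} :=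
  [set C in P | [exists y in C, g x y]].

Lemma touchingP (P : {set {set T}}) x C :
  reflect (C \in P /\ exists2 y, y \in C & g x y) (C \in touching P x).
Proof.
rewrite inE; apply: (iffP andP) => -[CP ?]; split=> //; exact/exists_inP.
Qed.

(** In a smallest barrier every element touches at least three parts: if [x]
    touches at most two, taking [x] back loses at most two odd parts, whereas the
    evenness of [A] makes the excess of odd parts over [#|S|] at least 2, so
    that a smaller barrier would remain. *)
Lemma minimal_barrier (A : {set T}) : ~~ odd #|A| ->
    (exists m, perfect_matching A m) \/
    (exists S P, [/\ separation A S P, #|S| < #|odd_parts P|
                   & {in S, forall x, 2 < #|touching P x|}]).
Proof.
move=> evenA; have [|[S0 [P0 [sep0 lt0]]]] := tutte A; [by left|right].
pose barrier S := [exists P, separation A S P && (#|S| < #|odd_parts P|)].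
have barrier0 : barrier S0 by apply/existsP; exists P0; rewrite sep0.
have [S /existsP[P /andP[sepP ltP]] minS] :=
  arg_minnP (fun S : {set T} => #|S|) barrier0.
exists S, P; split=> // x xS; rewrite ltnNge; apply/negP=> le2.
have /separationP[sSA partP _] := sepP.
have x0 : [set x] != set0 by apply/set0Pn; exists x; rewrite inE.
have sxS : [set x] \subset S by rewrite sub1set.
have sTP : touching P x \subset P by apply/subsetP=> C /touchingP[].
have xT z y C : z \in [set x] -> C \in P -> y \in C -> g z y -> C \in touching P x.
  by move=> /set1P-> CP yC gxy; apply/touchingP; split=> //; exists y.
have sep' := separation_merge sepP sxS x0 sTP xT.
have leT : #|odd_parts (touching P x)| <= 2.
  by apply: leq_trans le2; apply/subset_leq_card/subsetP=> C; rewrite inE => /andP[].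
have := card_odd_parts_merge P ([set x] :|: cover (touching P x)) (touching P x).
set P' := _ |: _ => leP'.
have lt : #|S :\ x| < #|odd_parts P'|.
  move: (odd_card_partition partP) evenA (cardsID S A) (cardsD1 x S) ltP leT leP'.
  rewrite (setIidPr sSA) xS.
  move: #|odd_parts P'| #|odd_parts P| #|odd_parts _| #|A :\: S| #|A| #|S| #|_ :\ _|.
  by clear; lia.
have : barrier (S :\ x) by apply/existsP; exists P'; rewrite sep'.
by move/minS; rewrite (cardsD1 x S) xS ltnn.
Qed.
End Tutte.

(** * The gadget graph *)

Lemma even_card_involution (T : finType) (B : {set T}) (m : T -> T) :
    {in B, forall x, [/\ m x \in B, m x != x & m (m x) = x]} -> ~~ odd #|B|.
Proof.
have [n] := ubnP #|B|; elim: n => // n IHn in B *; rewrite ltnS => leBn mP.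
have [->|[a aB]] := set_0Vmem B; first by rewrite cards0.
have [maB maa mma] := mP a aB.
have cardB : #|B| = #|B :\ a :\ m a|.+2.
  by rewrite (cardsD1 a) aB (cardsD1 (m a) (B :\ a)) !inE maa maB.
rewrite cardB /= negbK; apply: IHn; first by apply: leq_trans leBn; rewrite cardB.
move=> x; rewrite !inE => /and3P[xma xa xB]; have [mxB mxx mmx] := mP x xB.
split=> //; rewrite mxB andbT; apply/andP; split.
  by apply: contraNneq xa => E; rewrite -mmx E mma.
by apply: contraNneq xma => <-; rewrite mmx.
Qed.

(** An edge of the cut is recorded once, as the ordered pair that leaves [W]. *)
Definition edge_cut (V : finType) (e : rel V) (W : {set V}) : {set V * V} :=
  [set p | [&& p.1 \in W, p.2 \notin W & e p.1 p.2]].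

Section Gadget.
Variables (V : finType) (e : rel V).
Hypothesis e_simple : simple_graph e.
Hypothesis deg3 : forall v, 3 <= degree e v.
Hypothesis no_bridge : forall W : {set V}, #|edge_cut e W| != 1.

Local Notation gadget := (V * (V + bool))%type.

(** The element [(v, inl w)] is the dart at [v] of the edge [v w], and the
    elements [(v, inr b)] are the two cores of [v]. Each dart is joined to its
    reverse and to everything else at the same vertex; cores are not joined to
    each other, so that each of them is matched with a dart. *)
Definition gadget_adj : rel gadget := fun x y =>
  match x.2, y.2 with
  | inl a, inl b => (x.1 == y.1) && (a != b) || (x.1 == b) && (y.1 == a)
  | inr _, inr _ => false
  | _, _ => x.1 == y.1
  end.

Definition gadget_set : {set gadget} :=
  [set x : gadget | if x.2 is inl w then e x.1 w else true].

(** On darts, this is the reversal of the edge; the exchange of the two cores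
    makes it an involution without fixed points on the whole gadget graph, which
    settles all the parity questions below. *)
Definition twin (x : gadget) : gadget :=
  match x.2 with inl w => (w, inl x.1) | inr b => (x.1, inr (~~ b)) end.

Definition is_core (x : gadget) : bool := if x.2 is inr _ then true else false.

Let A := gadget_set.
Let g := gadget_adj.

Lemma gadget_adj_sym : symmetric gadget_adj.
Proof.
case: e_simple => eC _ [v [a|a]] [w [b|b]]; rewrite /gadget_adj //= 1?eq_sym //.
by rewrite [b == a]eq_sym [(w == a) && _]andbC.
Qed.

Lemma twin_in x : x \in A -> twin x \in A.
Proof. by case: e_simple => eC _; case: x => v [w|b]; rewrite !inE //= eC. Qed.

Lemma twinK : involutive twin.
Proof. by case=> v [w|b]; rewrite /twin //= negbK. Qed.

Lemma twin_neq x : x \in A -> twin x != x.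
Proof.
case: e_simple => _ eirr; case: x => v [w|b]; rewrite inE /twin /= => evw.
  by apply: contraTneq evw => -[->]; rewrite eirr.
by apply/eqP=> -[]; case: b evw.
Qed.

Lemma gadget_adj_cases x y : g x y -> y.1 = x.1 \/ ~~ is_core x /\ y = twin x.
Proof.
case: x y => [v [a|a]] [w [b|b]]; rewrite /g /gadget_adj /twin //=.
- by case/orP=> /andP[/eqP->]; [left|move/eqP->; right].
- by move/eqP; left.
- by move/eqP; left.
Qed.

Lemma gadget_adj_irr x : x \in A -> ~~ g x x.
Proof.
case: e_simple => _ eirr; case: x => v [w|b]; rewrite inE /g /gadget_adj //= eqxx /= => evw.
rewrite eqxx andbb /=; by apply: contraTneq evw => ->; rewrite eirr.
Qed.

Lemma gadget_adj_owner x y :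
  x.1 = y.1 -> x != y -> ~~ (is_core x && is_core y) -> g x y.
Proof.
case: x y => [v [a|a]] [w [b|b]]; rewrite /g /gadget_adj //= => -> neq _; rewrite ?eqxx //=.
by apply/orP; left; apply: contraNneq neq => ->.
Qed.

Lemma gadget_adj_twin x : x \in A -> ~~ is_core x -> g x (twin x).
Proof. by case: x => v [w|b] //= _ _; rewrite /g /gadget_adj /= !eqxx orbT. Qed.

(** The subgraph consists of the edges whose two darts are not matched with each
    other. The matching is an involution without fixed points on the elements of
    the gadget of [v] whose partner is also at [v]: these are the darts of the
    selected edges at [v] and the two cores, hence their number is even. It is
    more than 2, since the partner of a core is a dart. *)
Lemma even_of_matching m :
  perfect_matching g A m -> exists h : rel V, spanning_subgraph h e /\ even_graph h.
Proof.
case: (e_simple) => eC eirr mP.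
pose h v w := e v w && ((m (v, inl w)).1 == v).
have dartA v w : e v w -> (v, inl w) \in A by rewrite inE.
have hE v w : h v w = e v w && (m (v, inl w) != twin (v, inl w)).
  rewrite /h; case evw: (e v w) => //=; have [_ gx _] := mP _ (dartA v w evw).
  case: (gadget_adj_cases gx) => [/= E|[_ E]].
    rewrite E eqxx; apply/esym/eqP => E'.
    by move: evw; rewrite -E E' /= eirr.
  by rewrite E eqxx /=; apply: contraTF evw => /eqP ->; rewrite eirr.
have hsym : symmetric h.
  suff hs v w : h v w -> h w v by move=> v w; apply/idP/idP; exact: hs.
  rewrite !hE => /andP[evw neq]; rewrite eC evw /=; apply: contraNneq neq => E.
  have [_ _] : [/\ m (w, inl v) \in A, g (w, inl v) (m (w, inl v))
       & m (m (w, inl v)) = (w, inl v)] by apply: mP; rewrite dartA // eC.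
  by rewrite E => E'; apply/eqP; exact: E'.
exists h; split.
  by split; [split=> // v; rewrite /h eirr|move=> v w /andP[]].
move=> v; split.
  have coreA : (v, inr true) \in A by rewrite inE.
  have [mA gm mm] := mP _ coreA.
  case E: (m (v, inr true)) mA gm mm => [v' [w|b]]; rewrite /g /gadget_adj //=.
  rewrite inE /= => ev'w /eqP vv' mm; rewrite card_gt0; apply/set0Pn; exists w.
  by rewrite inE /h vv' ev'w mm /= vv' eqxx.
pose D := [set y in A | (y.1 == v) && ((m y).1 == v)].
have evenD : ~~ odd #|D|.
  apply: (@even_card_involution _ D m) => y; rewrite inE => /and3P[yA /eqP yv /eqP myv].
  have [mA gm mm] := mP y yA; rewrite inE mA mm myv yv eqxx; split=> //.
  by apply: contraNneq (gadget_adj_irr yA) => E; rewrite -{2}E.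
have DE : D = [set (v, inl w) | w in [set w | h v w]] :|: [set (v, inr true); (v, inr false)].
  apply/setP=> -[v' [w|b]]; rewrite !inE /=.
    have neq b' : ((v', inl w) == (v, inr b') :> gadget) = false by apply/eqP.
    rewrite !neq !orbF; apply/idP/imsetP.
      by case/and3P=> + /eqP E; rewrite E => ev mv; exists w; rewrite // inE /h ev.
    by case=> w'; rewrite inE /h => /andP[ev /eqP mv] [-> ->]; rewrite ev eqxx mv /=.
  have -> : ((v', inr b) \in [set (v, inl w) | w in [set w | h v w]] :> bool) = false.
    by apply/imsetP=> -[].
  have bA : (v', inr b) \in A by rewrite inE.
  have [_ gm _] := mP _ bA; case: (gadget_adj_cases gm) => [/= ->|[]] //.
  rewrite andbb /= -!pair_eqE /= /pair_eq /=.
  by case: b {bA gm}; rewrite ?andbT ?andbF ?orbF.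
have cc : (v, inr true) != (v, inr false) :> gadget by apply/eqP=> -[].
have := evenD; rewrite DE cardsU cards2 (_ : _ :&: _ = set0) ?cards0 ?subn0.
  rewrite card_imset; last by move=> a b [].
  by rewrite cc addn2 /= negbK.
by apply/setP=> x; rewrite !inE; apply/andP=> -[/imsetP[w _ ->] /orP[]/eqP].
Qed.

Lemma even_gadget_set : ~~ odd #|A|.
Proof.
by apply: (@even_card_involution _ A twin) => x xA; rewrite twin_in // twin_neq // twinK.
Qed.

Lemma dart_exists v : exists w, e v w.
Proof.
have : 0 < degree e v by apply: leq_trans (deg3 v).
by rewrite card_gt0 => /set0Pn[w]; rewrite inE; exists w.
Qed.

Lemma card_darts v : #|[set x in A | ~~ is_core x & x.1 == v]| = degree e v.
Proof.
rewrite /degree -(card_imset (f := fun w => (v, inl w) : gadget)) => [|a b []] //.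
apply: eq_card => -[v' [w|b]]; rewrite !inE /=; last first.
  by apply/esym/imsetP=> -[].
apply/andP/imsetP=> [[ev /eqP E]|[w' ew' [-> ->]]]; last by rewrite inE in ew'.
by exists w; rewrite ?inE -E.
Qed.

(** * Counting the odd parts of a smallest barrier *)

Section Count.
Variables (S : {set gadget}) (P : {set {set gadget}}).
Hypothesis sepP : separation g A S P.
Hypothesis min_S : {in S, forall x, 2 < #|touching g P x|}.

(** One dart outside [S] links all the elements of its gadget outside [S]. *)
Lemma same_owner_same_part t C y z :
    t \in A :\: S -> ~~ is_core t -> y.1 = t.1 -> z.1 = t.1 ->
    C \in P -> y \in C -> z \in A :\: S -> z \in C.
Proof.
have /separationP[_ _ edgeP] := sepP.
move=> tA tc yt zt CP yC zA.
have tC : t \in C.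
  have [<- //|yt'] := eqVneq y t.
  by apply: edgeP yC tA _; rewrite // gadget_adj_owner // (negPf tc) andbF.
have [-> //|zt'] := eqVneq z t.
by apply: edgeP tC zA _; rewrite // gadget_adj_owner // 1?eq_sym // (negPf tc).
Qed.

(** If a dart [t] of the same gadget as [x] is outside [S], then [x] touches only
    the part of [t] and that of its own twin. *)
Lemma barrier_takes_all_darts x t :
  x \in S -> t \in A -> ~~ is_core t -> t.1 = x.1 -> t \in S.
Proof.
have /separationP[sSA /and3P[/eqP covP trivP _] edgeP] := sepP.
move=> xS tA tc tx; apply/negPn/negP=> tS.
have tAS : t \in A :\: S by rewrite inE tS.
have : #|touching g P x| <= #|[set pblock P t; pblock P (twin x)]|.
  apply/subset_leq_card/subsetP=> C /touchingP[CP [y yC gxy]]; rewrite !inE.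
  have [yx|[_ E]] := gadget_adj_cases gxy; last by rewrite -E (def_pblock trivP CP yC) eqxx orbT.
  have tC := same_owner_same_part tAS tc (etrans yx (esym tx)) erefl CP yC tAS.
  by rewrite (def_pblock trivP CP tC) eqxx.
by rewrite leqNgt cards2; case: (_ != _); rewrite // (leq_trans _ (min_S xS)) // ltnW.
Qed.

Let owners := [set x.1 | x in S].
Let cores := [set x : gadget | (x.1 \in owners) && is_core x].

(** Each gadget that meets [S] has two cores and, in [S], at least three darts. *)
Lemma card_cores : 3 * #|cores| <= 2 * #|S|.
Proof.
have cores_of v : #|[set x : gadget | (x.1 == v) && is_core x]| <= 2.
  apply: leq_trans (_ : #|[set (v, inr true); (v, inr false)] : {set gadget}| <= 2); last first.
    by rewrite cards2; case: (_ != _).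
  apply/subset_leq_card/subsetP=> -[v' [w|b]]; rewrite !inE /= ?andbF // andbT => /eqP->.
  by case: b; rewrite eqxx ?orbT.
have darts_of v : v \in owners -> 3 <= #|[set x in S | x.1 == v]|.
  case/imsetP=> x xS ->; apply: leq_trans (deg3 x.1) _; rewrite -card_darts.
  apply/subset_leq_card/subsetP=> t; rewrite inE => /and3P[tA tc /eqP tx].
  by rewrite inE tx eqxx andbT (barrier_takes_all_darts xS).
have cardE (B : {set gadget}) : (forall x, x \in B -> x.1 \in owners) ->
    #|B| = \sum_(v in owners) #|[set x in B | x.1 == v]|.
  move=> Bo; rewrite -sum1_card (partition_big fst (mem owners)) //=.
  by apply: eq_bigr => v _; rewrite -sum1_card; apply: eq_bigl => x; rewrite inE.
rewrite (cardE cores); last by move=> x; rewrite inE => /andP[].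
rewrite (cardE S); last by move=> x xS; apply: imset_f.
rewrite !big_distrr /=; apply: leq_sum => v vo.
apply: leq_trans (_ : 3 * 2 <= _); last by rewrite mulnC leq_mul2l darts_of.
rewrite leq_mul2l /=; apply: leq_trans (cores_of v); apply/subset_leq_card/subsetP=> x.
by rewrite !inE => /andP[/andP[_ ->] ->].
Qed.

(** Such a part is the union of the gadgets over a vertex set [W]. The twin
    involution pairs off its elements, except for the darts of the edges that
    leave [W]; so the cut of [W] is odd, hence of size at least 3. The twins of
    these darts lie outside the part and are adjacent to it: they are in [S]. *)
Lemma coreless_odd_part C : C \in P -> odd #|C| -> [disjoint C & cores] ->
  3 <= #|[set x in S | twin x \in C]|.
Proof.
have /separationP[sSA /and3P[/eqP covP trivP _] edgeP] := sepP.
move=> CP oddC disjC.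
have CA y : y \in C -> y \in A :\: S.
  by move=> yC; rewrite -covP; apply/bigcupP; exists C.
have Cowner y : y \in C -> y.1 \notin owners.
  move=> yC; have := CA y yC; rewrite inE => /andP[yS yA].
  apply: contraNN yS => yo; case/imsetP: (yo) => x xS yx.
  apply: barrier_takes_all_darts xS yA _ yx.
  by apply: contraFN (disjointFr disjC yC) => yc; rewrite inE yo.
have Cclosed y z : y \in C -> z \in A -> z.1 = y.1 -> z \in C.
  move=> yC zA zy; have [w ew] := dart_exists y.1.
  have nS t : t.1 = y.1 -> t \notin S.
    by move=> ty; apply: contra (Cowner y yC) => tS; rewrite -ty imset_f.
  by apply: (@same_owner_same_part (y.1, inl w) C y z); rewrite // inE nS // inE.
pose W := [set x.1 | x in C].
have CE x : (x \in C) = (x \in A) && (x.1 \in W).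
  apply/idP/andP=> [xC|[xA /imsetP[y yC xy]]]; last exact: Cclosed yC xA xy.
  by rewrite imset_f //; have := CA x xC; rewrite inE => /andP[].
pose B := [set x in C | twin x \in C].
have evenB : ~~ odd #|B|.
  apply: (@even_card_involution _ B twin) => x; rewrite inE => /andP[xC txC].
  rewrite inE txC twinK xC twin_neq //.
  by move: xC; rewrite CE => /andP[].
have cutE : #|C :\: B| = #|edge_cut e W|.
  rewrite -(card_imset (f := fun p : V * V => (p.1, inl p.2) : gadget)); last first.
    by move=> [a b] [c d] [-> ->].
  apply: eq_card => -[v [w|b]]; rewrite !inE !CE !inE /=.
    apply/idP/imsetP.
      case/and3P=> + evw vW; rewrite evw vW /= => ewW.
      exists (v, w); rewrite // inE /= vW evw andbT.
      by apply: contra ewW => ->; rewrite andbT; case: e_simple => <-.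
    by case=> -[a b]; rewrite inE /= => /and3P[aW bW eab] [-> ->]; rewrite aW eab (negPf bW) andbF.
  by rewrite andbb andNb; apply/esym/imsetP=> -[].
have oddCB : odd #|C :\: B|.
  have sBC : B \subset C by apply/subsetP=> x; rewrite inE => /andP[].
  by move: oddC; rewrite -(cardsID B C) (setIidPr sBC) oddD (negPf evenB).
have le : #|C :\: B| <= #|[set x in S | twin x \in C]|.
  rewrite -(card_imset _ (inv_inj twinK)); apply/subset_leq_card/subsetP=> _ /imsetP[x xCB ->].
  move: xCB; rewrite !inE twinK => /andP[xB xC]; rewrite xC /= in xB *; rewrite andbT.
  have xA : x \in A by move: xC; rewrite CE => /andP[].
  apply: contraNT xB => txS; have [xc|xc] := boolP (is_core x).
    by apply: Cclosed xC (twin_in xA) _; move: xc; case: (x) => ? [].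
  by apply: edgeP xC _ (gadget_adj_twin xA xc); rewrite // inE txS twin_in.
apply: leq_trans le; move: oddCB (no_bridge W); rewrite cutE.
by case: #|_| => [|[|[|]]].
Qed.

(** A part that contains a core is charged to that core, and any other odd part
    to at least three elements of [S] whose twins it contains; no element of [S]
    is charged twice, because the parts are disjoint. *)
Lemma minimal_barrier_fails : #|odd_parts P| <= #|S|.
Proof.
have /separationP[sSA /and3P[/eqP covP trivP _] edgeP] := sepP.
pose O := [set C in odd_parts P | [disjoint C & cores]].
have leO : 3 * #|O| <= #|S|.
  have le1 y : \sum_(C in O) (y \in C) <= 1.
    have [/exists_inP[C CO yC]|/exists_inPn noC] := boolP [exists C in O, y \in C].
      rewrite (bigD1 C) //= yC big1 // => D /andP[DO DC]; apply/eqP; rewrite eqb0.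
      move: CO DO; rewrite !inE => /andP[/andP[CP _] _] /andP[/andP[DP _] _].
      by apply: contra DC => yD; rewrite -(def_pblock trivP CP yC) (def_pblock trivP DP yD).
    by rewrite big1 // => C CO; rewrite (negPf (noC C CO)).
  rewrite -sum1_card big_distrr /= -[X in _ <= X]sum1_card.
  apply: leq_trans (_ : \sum_(C in O) \sum_(x in S) (twin x \in C) <= _).
    apply: leq_sum => C; rewrite !inE muln1 => /andP[/andP[CP oddC] disjC].
    apply: leq_trans (coreless_odd_part CP oddC disjC) _.
    rewrite -sum1_card big_mkcond [X in _ <= X]big_mkcond /= leq_sum // => x _.
    by rewrite inE; case: (x \in S); case: (twin x \in C).
  by rewrite exchange_big leq_sum // => x _; exact: le1.
have leK : #|odd_parts P :\: O| <= #|cores|.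
  apply: leq_trans (leq_imset_card (pblock P) cores).
  apply/subset_leq_card/subsetP=> C; rewrite !inE negb_and.
  case/andP=> + /andP[CP oddC]; rewrite CP oddC /= -setI_eq0 => /set0Pn[y /setIP[yC yK]].
  by apply/imsetP; exists y; rewrite // (def_pblock trivP CP yC).
have sO : O \subset odd_parts P by apply/subsetP=> C; rewrite inE => /andP[].
move: card_cores leO leK; rewrite -(cardsID O (odd_parts P)) (setIidPr sO).
move: #|O| #|_ :\: _| #|cores| #|S|; clear; lia.
Qed.
End Count.

Theorem even_spanning_subgraph_of_bridgeless :
  exists h : rel V, spanning_subgraph h e /\ even_graph h.
Proof.
have [[m mP]|[S [P [sepP lt min_S]]]] := minimal_barrier gadget_adj_sym even_gadget_set.
  exact: even_of_matching mP.
by have := minimal_barrier_fails sepP min_S; rewrite leqNgt lt.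
Qed.

End Gadget.

(** * A bound for the second smallest eigenvalue *)

Local Open Scope ring_scope.

Section SpectralBound.
Local Open Scope sesquilinear_scope.

Lemma char_poly_conj (F : fieldType) n (P B : 'M[F]_n) :
  P \in unitmx -> char_poly (invmx P *m B *m P) = char_poly B.
Proof.
move=> uP; rewrite /char_poly.
have -> : char_poly_mx (invmx P *m B *m P) =
    map_mx polyC (invmx P) *m char_poly_mx B *m map_mx polyC P.
  rewrite /char_poly_mx mulmxBr mulmxBl -!map_mxM; congr (_ - _).
  by rewrite [_ *m 'X%:M]scalar_mxC -mulmxA -map_mxM mulVmx // map_mx1 mulmx1.
rewrite !det_mulmx mulrAC -det_mulmx -map_mxM mulVmx // map_mx1 det1 mul1r //.
Qed.

Section Rayleigh.
Variables (C : numClosedFieldType) (n : nat) (B : 'M[C]_n) (c : C) (i0 : 'I_n).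
Hypothesis normalB : B \is normalmx.
Hypothesis large : forall i, i != i0 -> c < spectral_diag B 0 i.

(** If [z] is the row of coordinates of [y] in an orthonormal basis of
    eigenvectors, the difference of the two sides is the sum of the terms
    [(spectral_diag B 0 i - c) * `|z 0 i| ^+ 2], and the only term that might be
    negative is killed by [z 0 i0 = 0]. *)
Lemma rayleigh_gt (y : 'rV[C]_n) :
    y != 0 -> (y *m invmx (spectralmx B)) 0 i0 = 0 ->
  c * (y *m y^t*) 0 0 < (y *m B *m y^t*) 0 0.
Proof.
set P := spectralmx B; set D := spectral_diag B; set z := y *m _ => y0 z0.
have uP : P \in unitmx := spectral_unit B.
have PP : P *m P^t* = 1%:M by apply/unitarymxP; exact: spectral_unitarymx.
have yE : y = z *m P by rewrite /z mulmxKV.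
have zn0 : z != 0 by apply: contraNneq y0 => E; rewrite yE E mul0mx.
have -> : y *m y^t* = z *m z^t*.
  by rewrite yE trmx_mul map_mxM mulmxA -(mulmxA z) PP mulmx1.
have -> : y *m B *m y^t* = z *m diag_mx D *m z^t*.
  rewrite (orthomx_spectralP normalB) -/P -/D !mulmxA -/z {1}yE trmx_mul map_mxM.
  by rewrite !mulmxA -(mulmxA (z *m _)) PP mulmx1.
rewrite -subr_gt0 [X in _ < X - _]mxE [X in _ * X]mxE mulr_sumr -sumrB.
have E i : (z *m diag_mx D) 0 i * (z^t*) i 0 - c * (z 0 i * (z^t*) i 0) =
    (D 0 i - c) * `|z 0 i| ^+ 2.
  by rewrite mul_mx_diag !mxE normCK mulrBl; congr (_ - _); rewrite mulrAC mulrC.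
rewrite (eq_bigr _ (fun i _ => E i)).
have ge0 i : 0 <= (D 0 i - c) * `|z 0 i| ^+ 2.
  have [->|ii0] := eqVneq i i0; first by rewrite z0 normr0 expr0n mulr0.
  by rewrite mulr_ge0 ?exprn_ge0 // subr_ge0 ltW ?large.
have [i zi] : exists i, z 0 i != 0 by apply/rV0Pn.
have ii0 : i != i0 by apply: contraNneq zi => ->; rewrite z0.
rewrite (bigD1 i) //= ltr_wpDr ?sumr_ge0 //.
by rewrite mulr_gt0 ?subr_gt0 ?large // exprn_gt0 // normr_gt0.
Qed.
End Rayleigh.

(** The case of the Courant-Fischer principle where the plane of test vectors is
    spanned by a null vector [u] and by [x]. If the second eigenvalue exceeded
    [c], then all eigenvalues but one, of index [i0], would; some nonzero vector
    of the plane has coordinate 0 along the eigenvector of index [i0], and its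
    Rayleigh quotient is both larger than [c], by [rayleigh_gt], and at most [c].
    The computation takes place over the complex extension of [R], where the
    spectral theorem for normal matrices applies. *)
Lemma second_eigenvalue_le (R : rcfType) n (A : 'M[R]_n) (mu : seq R)
    (u x : 'rV[R]_n) (c : R) :
    A^T = A -> ordered_eigenvalues A mu ->
    u != 0 -> u *m A = 0 -> x != 0 -> x *m u^T = 0 ->
    0 <= c -> (x *m A *m x^T) 0 0 <= c * (x *m x^T) 0 0 ->
  mu`_1 <= c.
Proof.
move=> symA [sorted_mu char_mu] u0 uA x0 xu c0 xAx; rewrite leNgt; apply/negP=> c_lt.
pose f := real_complex R; pose B := map_mx f A.
have conjf (a : R) : (f a)^* = f a by apply/CrealP; rewrite complex_real.
have conjM p q (M : 'M[R]_(p, q)) : (map_mx f M)^t* = map_mx f M^T.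
  by apply/matrixP=> i j; rewrite !mxE conjf.
have normalB : B \is normalmx by apply/normalmxP; rewrite conjM symA.
pose D := spectral_diag B.
have perm_mu : perm_eq [seq f a | a <- mu] [seq D 0 i | i <- enum 'I_n].
  apply: prod_XsubC_eq; rewrite !big_map.
  have -> : \prod_(j <- mu) ('X - (f j)%:P) = map_poly f (char_poly A).
    rewrite char_mu rmorph_prod; apply: eq_bigr => a _.
    by rewrite rmorphB /= map_polyX map_polyC.
  rewrite map_char_poly -/B (orthomx_spectralP normalB) char_poly_conj ?spectral_unit //.
  rewrite char_poly_trig ?diag_mx_is_trig // -enumT big_enum /=; apply: eq_bigr => i _.
  by rewrite mxE eqxx.
have [i0 large] : exists i0, forall i, i != i0 -> f c < D 0 i.
  have /rV0Pn[j0 _] := u0.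
  have le1 : (#|[pred i | ~~ (f c < D 0 i)%R]| <= 1)%N.
    rewrite cardE size_filter -(count_map (D 0) (fun z => ~~ (f c < z))).
    rewrite -enumT -(permP perm_mu) count_map.
    case: (mu) sorted_mu c_lt => [|a [|b s]] //=; first by case: (~~ _).
    move=> /andP[_ pb] c_lt; rewrite [(f c < f b)%R]ltcR c_lt /= add0n.
    rewrite (eq_in_count (a2 := pred0)) ?count_pred0 ?addn0; first by case: (~~ _).
    move=> d ds /=; rewrite ltcR (lt_le_trans c_lt) //.
    by move: pb; rewrite (path_sortedE le_trans) => /andP[/allP/(_ _ ds)].
  case: (pickP [pred i | ~~ (f c < D 0 i)]) => [i0 /= Di0|all].
    exists i0 => i ii0; apply/negPn/negP=> Di.
    by case/negP: ii0; apply/eqP; exact: (card_le1_eqP le1).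
  by exists j0 => i _; have := all i; rewrite /= => /negbFE.
have := @rayleigh_gt _ n B (f c) i0 normalB large.
set Q := invmx _ => ray.
pose uc := map_mx f u; pose xc := map_mx f x.
have ucB : uc *m B = 0 by rewrite -map_mxM uA map_mx0.
(* The vector [y] below divides by this coordinate; if it is 0, use [u] itself. *)
have [zu|zu] := eqVneq ((uc *m Q) 0 i0) 0.
  have uc0 : uc != 0 by rewrite map_mx_eq0.
  have := ray uc uc0 zu; rewrite ucB mul0mx [X in _ < X]mxE.
  rewrite conjM -map_mxM [X in _ * X]mxE -rmorphM /=.
  rewrite [X in _ < X](_ : _ = f 0) // ltcR ltNge mulr_ge0 // mxE sumr_ge0 // => i _.
  by rewrite mxE -expr2 sqr_ge0.
pose a := - ((xc *m Q) 0 i0 / (uc *m Q) 0 i0); pose y := xc + a *: uc.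
have xu00 : xc *m uc^t* = 0 by rewrite conjM -map_mxM xu map_mx0.
have ux00 : uc *m xc^t* = 0.
  by rewrite conjM -map_mxM -[u *m _]trmxK trmx_mul trmxK xu trmx0 map_mx0.
have yx : y *m xc^t* = xc *m xc^t* by rewrite mulmxDl -scalemxAl ux00 scaler0 addr0.
have xx_gt0 : 0 < (x *m x^T) 0 0.
  have /rV0Pn[i xi] := x0; rewrite mxE (bigD1 i) //= mxE -expr2.
  rewrite ltr_pwDl ?sumr_ge0 //; last by move=> j _; rewrite mxE -expr2 sqr_ge0.
  by rewrite lt_def sqr_ge0 sqrf_eq0 xi.
have y0 : y != 0.
  apply/eqP=> E; move: yx; rewrite E mul0mx conjM -map_mxM => /matrixP/(_ 0 0).
  rewrite mxE [RHS]mxE [LHS](_ : _ = f 0) // => /complexI/eqP.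
  by rewrite eq_sym (gt_eqF xx_gt0).
have yz : (y *m Q) 0 i0 = 0.
  by rewrite mulmxDl -scalemxAl mxE [X in _ + X]mxE mulNr divfK ?subrr.
have yC : y^t* = xc^t* + a^* *: uc^t*.
  by rewrite /y linearD linearZ /= map_mxD map_mxZ.
have := ray y y0 yz.
have -> : y *m B *m y^t* = map_mx f (x *m A *m x^T).
  have xAu : x *m A *m u^T = 0.
    have : (u *m A *m x^T)^T = 0 by rewrite uA mul0mx trmx0.
    by rewrite !trmx_mul trmxK symA mulmxA.
  rewrite yC mulmxDl -scalemxAl ucB scaler0 addr0 mulmxDr -scalemxAr !conjM.
  by rewrite -!map_mxM xAu map_mx0 scaler0 addr0.
have -> : y *m y^t* = map_mx f (x *m x^T) + (`|a| ^+ 2) *: map_mx f (u *m u^T).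
  rewrite yC mulmxDl !mulmxDr -!scalemxAl -!scalemxAr xu00 ux00 !scaler0 addr0 add0r.
  by rewrite scalerA -normCK !conjM -!map_mxM.
have mapE (M N : 'M[R]_1) b :
    (map_mx f M + b *: map_mx f N) 0 0 = f (M 0 0) + b * f (N 0 0) by rewrite !mxE.
have ge0 : 0 <= f c * (`|a| ^+ 2 * f ((u *m u^T) 0 0)).
  apply: mulr_ge0; first by rewrite ler0c.
  apply: mulr_ge0; first exact: exprn_ge0.
  by rewrite ler0c mxE sumr_ge0 // => i _; rewrite mxE -expr2 sqr_ge0.
rewrite mapE [X in _ < X]mxE mulrDr => lt.
have : f c * f ((x *m x^T) 0 0) < f ((x *m A *m x^T) 0 0).
  by apply: le_lt_trans lt; rewrite lerDl.
by rewrite -rmorphM ltcR ltNge xAx.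
Qed.

End SpectralBound.

Section Eigenvalues.
Variables (R : rcfType) (n : nat) (M : 'M[R]_n) (mu : seq R).
Hypothesis muP : ordered_eigenvalues M mu.

Lemma size_ordered_eigenvalues : size mu = n.
Proof.
have [_ /(congr1 (fun p : {poly R} => size p))] := muP.
by rewrite size_char_poly size_prod_XsubC => -[].
Qed.

Lemma trace_le_largest : (0 < n)%N -> \tr M <= n%:R * mu`_n.-1.
Proof.
have [sorted_mu char_mu] := muP; move=> n0.
have sz := size_ordered_eigenvalues.
have -> : \tr M = \sum_(a <- mu) a.
  apply: oppr_inj; rewrite -char_poly_trace // char_mu -{1}sz coefPn_prod_XsubC //.
  by rewrite sz -lt0n.
rewrite (big_nth 0) sz big_mkord mulr_natl -[n in _ *+ n]card_ord -sumr_const.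
apply: ler_sum => i _; apply: (sorted_leq_nth le_trans le_refl) => //.
- by rewrite inE sz.
- by rewrite inE sz prednK.
- by rewrite -ltnS prednK.
Qed.
End Eigenvalues.

(** * Bridges and the Laplacian matrix *)

Section Cuts.
Variables (V : finType) (e : rel V).
Hypothesis e_simple : simple_graph e.

Lemma edge_cutC (W : {set V}) : #|edge_cut e (~: W)| = #|edge_cut e W|.
Proof.
case: e_simple => eC _; pose swap (p : V * V) := (p.2, p.1).
have swapK : involutive swap by case.
rewrite -(card_imset _ (inv_inj swapK)); apply: eq_card => -[a b].
apply/imsetP/idP=> [[[c d]]|].
  by rewrite !inE /= negbK eC => /and3P[cW dW ecd] [-> ->]; rewrite dW cW ecd.
rewrite inE /= => /and3P[aW bW eab]; exists (b, a) => //.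
by rewrite !inE /= negbK aW bW eC.
Qed.

(** If [W] were a single vertex, all the edges at this vertex would be in the
    cut. *)
Lemma bridge_side_gt1 (W : {set V}) :
  (forall v, (3 <= degree e v)%N) -> #|edge_cut e W| = 1%N -> (1 < #|W|)%N.
Proof.
case: e_simple => eC eirr deg3 cut1; rewrite ltnNge; apply/negP=> W1.
have /card_gt0P[[a b]] : (0 < #|edge_cut e W|)%N by rewrite cut1.
rewrite inE /= => /and3P[aW bW eab].
suff : (degree e a <= 1)%N by move=> /(leq_trans (deg3 a)).
rewrite -cut1 /degree -(card_imset (mem [set w | e a w]) (f := fun w => (a, w))) => [|? ? []] //.
apply/subset_leq_card/subsetP=> _ /imsetP[w + ->]; rewrite !inE /= aW => eaw.
rewrite eaw andbT /=; apply: contraTN eaw => wW.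
by rewrite (card_le1_eqP W1 _ _ wW aW) eirr.
Qed.
End Cuts.

Section Laplacian.
Variables (R : rcfType) (V : finType) (e : rel V).
Hypothesis e_simple : simple_graph e.
Local Notation L := (laplacian_mx R e).

(** Functions on the vertices as row vectors, in the enumeration of [V] that
    indexes the Laplacian matrix. *)
Definition row_of (phi : V -> R) : 'rV[R]_#|V| := \row_i phi (enum_val i).

Lemma sum_enum_val (F : V -> R) : \sum_(i < #|V|) F (enum_val i) = \sum_v F v.
Proof. by rewrite [RHS](reindex _ (onW_bij _ (@enum_val_bij V))). Qed.

Lemma row_ofM (phi psi : V -> R) :
  (row_of phi *m (row_of psi)^T) 0 0 = \sum_v phi v * psi v.
Proof. by rewrite mxE -sum_enum_val; apply: eq_bigr => i _; rewrite !mxE. Qed.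

Lemma laplacian_sym : L^T = L.
Proof.
case: e_simple => eC _; rewrite /laplacian_mx /degree_mx linearB /= tr_diag_mx.
by congr (_ - _); apply/matrixP=> i j; rewrite !mxE eC.
Qed.

Lemma row_of_laplacian (phi : V -> R) :
  row_of phi *m L = row_of (fun v => \sum_w (phi v - phi w) * (e v w)%:R).
Proof.
case: e_simple => eC _.
apply/rowP=> j; rewrite /laplacian_mx mulmxBr mul_mx_diag !mxE.
rewrite /degree -sum1_card natr_sum big_mkcond mulr_sumr -sum_enum_val.
rewrite -[X in _ = X]sum_enum_val -sumrB; apply: eq_bigr => i _.
rewrite !mxE inE (eC (enum_val i)) mulrBl; congr (_ * _ - _).
by case: (e _ _).
Qed.

Lemma trace_laplacian : \tr L = \sum_v (degree e v)%:R.
Proof.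
case: e_simple => _ eirr; rewrite /mxtrace -sum_enum_val; apply: eq_bigr => i _.
by rewrite !mxE eqxx eirr subr0.
Qed.

(** The indicator of [W], scaled and shifted to be orthogonal to the constants. *)
Definition cut_vector (W : {set V}) (v : V) : R :=
  if v \in W then #|~: W|%:R else - #|W|%:R.

Lemma sum_cut (W : {set V}) (a b : R) :
  \sum_v (if v \in W then a else b) = #|W|%:R * a + #|~: W|%:R * b.
Proof.
rewrite (bigID (mem W)) /=; congr (_ + _).
  by rewrite (eq_bigr (fun=> a)) => [|v ->]; rewrite ?sumr_const ?mulr_natl.
rewrite (eq_bigr (fun=> b)) => [|v /negPf->]; rewrite ?mulr_natl // -sumr_const.
by apply: eq_bigl => v; rewrite inE.
Qed.

Lemma cut_vector_orthogonal (W : {set V}) :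
  row_of (cut_vector W) *m (row_of (fun=> 1))^T = 0.
Proof.
apply/matrixP=> i j; rewrite !ord1 row_ofM mxE.
under eq_bigr do rewrite mulr1.
by rewrite sum_cut mulrN mulrC subrr.
Qed.

Lemma cut_vector_norm (W : {set V}) :
  (row_of (cut_vector W) *m (row_of (cut_vector W))^T) 0 0 =
    #|V|%:R * (#|W| * #|~: W|)%:R.
Proof.
rewrite row_ofM (eq_bigr (fun v => if v \in W then #|~: W|%:R ^+ 2 else #|W|%:R ^+ 2)).
  by rewrite sum_cut -(cardsC W) natrD natrM; ring.
by move=> v _; rewrite /cut_vector; case: ifP => _; rewrite ?mulrNN.
Qed.

(** The Laplacian sees only the edges of the cut, across which the vector jumps
    by [#|W| + #|~: W|]. Pairs leaving [W] contribute with the factor [#|~: W|],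
    and the reversed pairs with the factor [#|W|]. *)
Lemma cut_vector_form (W : {set V}) :
  (row_of (cut_vector W) *m L *m (row_of (cut_vector W))^T) 0 0 =
    #|V|%:R ^+ 2 * #|edge_cut e W|%:R.
Proof.
have cutE U : #|edge_cut e U|%:R =
    \sum_v \sum_w ([&& v \in U, w \notin U & e v w])%:R :> R.
  rewrite pair_bigA /= -sum1_card natr_sum big_mkcond /=.
  by apply: eq_bigr => p _; rewrite inE; case: ifP.
rewrite row_of_laplacian row_ofM.
have -> : #|V|%:R ^+ 2 * #|edge_cut e W|%:R =
    #|V|%:R * #|~: W|%:R * #|edge_cut e W|%:R +
    #|V|%:R * #|W|%:R * #|edge_cut e (~: W)|%:R :> R.
  by rewrite edge_cutC // -(cardsC W) natrD; ring.
rewrite !cutE !mulr_sumr -big_split; apply: eq_bigr => v _ /=.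
rewrite mulr_suml !mulr_sumr -big_split; apply: eq_bigr => w _ /=.
rewrite !inE negbK /cut_vector -(cardsC W) natrD.
by case: (v \in W); case: (w \in W); case: (e v w) => /=; ring.
Qed.

End Laplacian.

(** A bridge would force the second eigenvalue down to 1, since
    [#|W| + #|~: W| <= #|W| * #|~: W|] as soon as both sides have at least two
    vertices, while the trace keeps the largest one above [delta]. *)
Lemma no_bridge_of_spectrum (R : rcfType) (V : finType) (e : rel V) (delta : nat)
    (mu : seq R) (W : {set V}) :
    simple_graph e -> (forall v, (delta <= degree e v)%N) -> (3 <= delta)%N ->
    ordered_eigenvalues (laplacian_mx R e) mu ->
    (delta%:R - 1) * mu`_1 >= mu`_(#|V|.-1) ->
  #|edge_cut e W| != 1%N.
Proof.
move=> e_simple deg_ge delta3 muP mu_cond; apply/negP=> /eqP cut1.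
have deg3 v : (3 <= degree e v)%N by apply: leq_trans (deg_ge v).
have W2 := bridge_side_gt1 e_simple deg3 cut1.
have W'2 : (1 < #|~: W|)%N.
  by apply: (bridge_side_gt1 e_simple deg3); rewrite edge_cutC.
have V0 : (0 < #|V|)%N by rewrite -(cardsC W) addn_gt0 ltnW.
have V0R : 0 < #|V|%:R :> R by rewrite ltr0n.
have mu1 : mu`_1 <= 1.
  apply: (second_eigenvalue_le (laplacian_sym R e_simple) muP (u := row_of (fun=> 1))
           (x := row_of (cut_vector R W))) => //.
  - by apply/rV0Pn; exists (Ordinal V0); rewrite mxE oner_eq0.
  - rewrite row_of_laplacian //; apply/rowP=> j; rewrite !mxE big1 // => w _.
    by rewrite subrr mul0r.
  - apply: contraTneq (V0R) => x0; have := cut_vector_norm R W.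
    rewrite x0 mul0mx mxE => /esym/eqP; rewrite mulf_eq0 => /orP[/eqP->|].
      by rewrite ltxx.
    by rewrite pnatr_eq0 muln_eq0 => /orP[]/eqP E; rewrite E in W2 W'2.
  - exact: cut_vector_orthogonal.
  - rewrite cut_vector_form // cut_vector_norm cut1 mulr1 mul1r expr2 ler_pM2l //.
    rewrite ler_nat -(cardsC W); move: #|W| #|~: W| W2 W'2; clear; nia.
have delta_le : delta%:R <= mu`_(#|V|.-1).
  rewrite -(ler_pM2l V0R); apply: le_trans (trace_le_largest muP V0).
  rewrite trace_laplacian // mulr_natl -sumr_const ler_sum // => v _.
  by rewrite ler_nat.
have delta3R : 3 <= delta%:R :> R by rewrite ler_nat.
have : (delta%:R - 1) * mu`_1 <= delta%:R - 1 by rewrite ler_piMr // subr_ge0; lra.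
lra.
Qed.

Theorem theorem4p1 (R : rcfType) (V : finType) (e : rel V) (delta : nat)
    (mu : seq R)
    (e_simple : simple_graph e)
    (delta_min : is_min_degree e delta)
    (delta_ge3 : (3 <= delta)%N)
    (mu_eig : ordered_eigenvalues (laplacian_mx R e) mu)
    (mu_cond : (delta%:R - 1) * mu`_1 >= mu`_(#|V|.-1)) :
  exists h : rel V, spanning_subgraph h e /\ even_graph h.
Proof.
case: delta_min => _ deg_ge; apply: even_spanning_subgraph_of_bridgeless => //.
  by move=> v; apply: leq_trans (deg_ge v).
by move=> W; apply: (@no_bridge_of_spectrum R V e delta mu W).
Qed.
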